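(* Let $e$ be an expression and $n$ an integer. If $e\Downarrow n$, i.e. $e\longrightarrow^* n$ in the small-step call-by-value semantics, then $\mathcal{E}[\![e]\!]\emptyset=\mathcal{E}[\![n]\!]\emptyset$ (where $\emptyset$ is the empty environment).
   Context: **Expressions.** $e ::= n \mid e\oplus e \mid x \mid \lambda x.\,e \mid e\;e \mid \mathbf{if}\,e\,\mathbf{then}\,e\,\mathbf{else}\,e$, with $n\in\mathbb{Z}$, $x$ a variable, and $\oplus\in\{+,\times,-,\ldots\}$ a total binary integer operation. **Domain.** $\mathbb{D}$ is inductively defined by $\mathbb{D}=\mathbb{Z}+\mathcal{P}_f(\mathbb{D}\times\mathbb{D})$ ($\mathcal{P}_f$ = finite subsets); $d$ ranges over $\mathbb{D}$, $t$ over finite subsets of $\mathbb{D}\times\mathbb{D}$ (''tables''). The order $\sqsubseteq$ on $\mathbb{D}$: $n\sqsubseteq n$ for integers; $t\sqsubseteq t'$ iff $t\subseteq t'$; nothing else. **Semantics.** For an environment $\rho$ (partial map from variables to $\mathbb{D}$), $\mathcal{E}[\![e]\!]\rho\subseteq\mathbb{D}$ is defined by recursion on $e$: - $\mathcal{E}[\![n]\!]\rho=\{n\}$; $\mathcal{E}[\![x]\!]\rho=\{d\mid d\sqsubseteq\rho(x)\}$ (empty if $\rho(x)$ is undefined); - $\mathcal{E}[\![e_1\oplus e_2]\!]\rho=\{n_1\oplus n_2\mid n_1\in\mathcal{E}[\![e_1]\!]\rho,\ n_2\in\mathcal{E}[\![e_2]\!]\rho,\ n_1,n_2\in\mathbb{Z}\}$;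 - $\mathcal{E}[\![\lambda x.e]\!]\rho=\{t\mid\forall(d,d')\in t.\ d'\in\mathcal{E}[\![e]\!]\rho(x{:=}d)\}$; - $\mathcal{E}[\![e_1\,e_2]\!]\rho=\{d\mid\exists t,d_1,d_1',d_2.\ t\in\mathcal{E}[\![e_1]\!]\rho,\ d_2\in\mathcal{E}[\![e_2]\!]\rho,\ (d_1,d_1')\in t,\ d_1\sqsubseteq d_2,\ d\sqsubseteq d_1'\}$; - $\mathcal{E}[\![\mathbf{if}\,e_1\,\mathbf{then}\,e_2\,\mathbf{else}\,e_3]\!]\rho=\{d\mid\exists n\in\mathbb{Z}.\ n\in\mathcal{E}[\![e_1]\!]\rho,\ (n\ne0\Rightarrow d\in\mathcal{E}[\![e_2]\!]\rho),\ (n=0\Rightarrow d\in\mathcal{E}[\![e_3]\!]\rho)\}$. **Small-step semantics.** Syntactic values $\overline{v} ::= n\mid\lambda x.e$ with $\lambda x.e$ closed. $e[\overline{v}/x]$ is substitution for free occurrences of $x$. $\longrightarrow$ is the standard call-by-value left-to-right reduction: $(\lambda x.e)\,\overline{v}\longrightarrow e[\overline{v}/x]$; $n_1\oplus n_2\longrightarrow n$ where $n$ is the integer $n_1\oplus n_2$; $\mathbf{if}\,n\,\mathbf{then}\,e_2\,\mathbf{else}\,e_3\longrightarrow e_2$ if $n\neq0$ and $\longrightarrow e_3$ if $n=0$; and congruence: if $e_1\longrightarrow e_1'$ then $e_1\,e_2\longrightarrow e_1'\,e_2$, $e_1\oplus e_2\longrightarrow e_1'\oplus e_2$, $\mathbf{if}\,e_1\,\mathbf{then}\,e_2\,\mathbf{else}\,e_3\longrightarrow\mathbf{if}\,e_1'\,\mathbf{then}\,e_2\,\mathbf{else}\,e_3$;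 if $e_2\longrightarrow e_2'$ then $\overline{v}\,e_2\longrightarrow\overline{v}\,e_2'$ and $\overline{v}\oplus e_2\longrightarrow\overline{v}\oplus e_2'$. $\longrightarrow^*$ is its reflexive transitive closure. *)

(* Defs.v *)
From HB Require Import structures.
From Stdlib Require Export Relation_Operators.
From mathcomp Require Export all_boot ssralg ssrint finmap.
From mathcomp Require Export boolp classical_sets.

Set Implicit Arguments.
Unset Strict Implicit.
Unset Printing Implicit Defensive.

Local Open Scope classical_set_scope.

(** * The domain

    [D] is the least solution of [D = int + {fset D * D}].  This equation is
    not a legal inductive definition ([{fset _}] is a subtype needing a
    [choiceType]), so [D] is carved out of a type of trees in which tables are
    lists: an element of [D] is a tree all of whose lists of pairs are the
    canonical enumerations of finite sets.  The rest of the development only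
    relies on the injections [dint] and [dtab]; [dint_inj], [dtab_inj],
    [dint_dtab], [D_case] and [D_elim] say that they generate [D] freely. *)

Inductive tree : Type :=
| TInt of int
| TTab of seq (tree * tree).

Fixpoint tree_code (a : tree) : GenTree.tree int :=
  match a with
  | TInt n => GenTree.Leaf n
  | TTab s => GenTree.Node 0
      [seq GenTree.Node 0 [:: tree_code p.1; tree_code p.2] | p <- s]
  end.

Fixpoint tree_decode (g : GenTree.tree int) : tree :=
  match g with
  | GenTree.Leaf n => TInt n
  | GenTree.Node _ gs => TTab
      [seq match g' with
           | GenTree.Node _ [:: g1; g2] => (tree_decode g1, tree_decode g2)
           | _ => (TInt 0, TInt 0)
           end | g' <- gs]
  end.

Lemma tree_codeK : cancel tree_code tree_decode.
Proof.
rewrite /cancel; fix IH 1 => -[n|s] //=; congr TTab.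
by elim: s => [|[a b] s /= ->] //; rewrite !IH.
Qed.

HB.instance Definition _ := Choice.copy tree (can_type tree_codeK).

Fixpoint canonical_tree (a : tree) : bool :=
  match a with
  | TInt _ => true
  | TTab s => (s == enum_fset [fset p in s]%fset)
              && all (fun p => canonical_tree p.1 && canonical_tree p.2) s
  end.

Definition D : Type := {a : tree | canonical_tree a}.

HB.instance Definition _ := SubChoice.on D.

Definition dint (n : int) : D := exist _ (TInt n) isT.

Definition table_seq (t : {fset D * D}) : seq (tree * tree) :=
  enum_fset [fset (val p.1, val p.2) | p in t]%fset.

Lemma table_seq_canonical (t : {fset D * D}) :
  canonical_tree (TTab (table_seq t)).
Proof.
apply/andP; split.
- by apply/eqP; congr enum_fset; apply/fsetP => p; rewrite inE.
- apply/allP => p /imfsetP[q _ ->] /=.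
  by apply/andP; split; exact: valP.
Qed.

Definition dtab (t : {fset D * D}) : D :=
  exist _ (TTab (table_seq t)) (table_seq_canonical t).

Lemma dint_inj : injective dint.
Proof. by move=> m n []. Qed.

Lemma dtab_inj : injective dtab.
Proof.
have im u p : (val p.1, val p.2) \in table_seq u -> p \in u.
  case: p => p1 p2 /imfsetP[[q1 q2] /= qu [/val_inj-> /val_inj->]] //.
move=> t u [tu]; apply/fsetP => p.
by apply/idP/idP => pP; apply: im; [rewrite -tu|rewrite tu];
  apply/imfsetP; exists p.
Qed.

Lemma dint_dtab (n : int) (t : {fset D * D}) : dint n <> dtab t.
Proof. by case. Qed.

Lemma canonical_tabE (s : seq (tree * tree)) (cs : canonical_tree (TTab s)) :
  exist _ (TTab s) cs =
  dtab [fset p in pmap (fun q : tree * tree =>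
          if (insub q.1 : option D, insub q.2 : option D) is (Some a, Some b)
          then Some (a, b) else None) s]%fset :> D.
Proof.
apply: val_inj => /=; congr TTab; have /andP[/eqP sE /allP sP] := cs.
rewrite {1}sE; congr enum_fset; apply/fsetP => -[a b]; rewrite inE /=.
apply/idP/imfsetP => [abs|[[a' b'] /=]].
- have /andP[/= ca cb] := sP _ abs.
  exists (exist _ a ca, exist _ b cb) => //=.
  rewrite inE mem_pmap; apply/mapP; exists (a, b) => //=.
  by rewrite !insubT.
- rewrite inE mem_pmap => /mapP[[c d] cds /=].
  case: insubP => // u _ uc; case: insubP => // v _ vd [-> ->] [-> ->].
  by rewrite uc vd.
Qed.

Lemma D_case (d : D) : (exists n, d = dint n) \/ (exists t, d = dtab t).
Proof.
case: d => -[n|s] cs; [left; exists n; exact: val_inj|right].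
by eexists; exact: canonical_tabE.
Qed.

Lemma D_elim (P : D -> Prop) :
  (forall n, P (dint n)) ->
  (forall t : {fset D * D}, (forall p, p \in t -> P p.1 /\ P p.2) ->
     P (dtab t)) ->
  forall d, P d.
Proof.
move=> Pint Ptab [a ca]; move: a ca; fix IH 1 => -[n|s] cs.
  by rewrite (_ : exist _ _ _ = dint n) //; exact: val_inj.
rewrite canonical_tabE; apply: Ptab => p; rewrite inE mem_pmap {cs}.
elim: s => //= -[a b] s IHs; rewrite inE => /orP[|]; last exact: IHs.
case: insubP => //= -[u cu] _ /= ua; case: insubP => //= -[v cv] _ /= vb.
move: cu cv; rewrite ua vb => cu cv /eqP[->] /=; split; exact: IH.
Qed.

Inductive dle : D -> D -> Prop :=
| dle_int (n : int) : dle (dint n) (dint n)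
| dle_tab (t t' : {fset D * D}) : (t `<=` t')%fset -> dle (dtab t) (dtab t').

Notation "d ⊑ d'" := (dle d d') (at level 70, no associativity).

(** * Expressions *)

Definition var : Type := nat.

(* An operator is represented by the total integer operation it denotes. *)
Inductive exp : Type :=
| Num of int
| Op of (int -> int -> int) & exp & exp
| Var of var
| Lam of var & exp
| App of exp & exp
| If of exp & exp & exp.

(** * Denotational semantics *)

Definition env : Type := var -> option D.

Definition empty_env : env := fun=> None.

Definition update (rho : env) (x : var) (d : D) : env :=
  fun y => if y == x then Some d else rho y.

Fixpoint denot (e : exp) (rho : env) : set D :=
  match e with
  | Num n => [set dint n]
  | Op f e1 e2 =>
      [set d | exists n1 n2 : int,
         [/\ denot e1 rho (dint n1), denot e2 rho (dint n2)
           & d = dint (f n1 n2)]]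
  | Var x => [set d | exists2 d', rho x = Some d' & d ⊑ d']
  | Lam x e1 =>
      [set d | exists2 t : {fset D * D}, d = dtab t &
         forall d1 d1', (d1, d1') \in t -> denot e1 (update rho x d1) d1']
  | App e1 e2 =>
      [set d | exists (t : {fset D * D}) (d1 d1' d2 : D),
         [/\ denot e1 rho (dtab t), denot e2 rho d2,
             (d1, d1') \in t, d1 ⊑ d2 & d ⊑ d1']]
  | If e1 e2 e3 =>
      [set d | exists n : int,
         [/\ denot e1 rho (dint n),
             n <> 0%R -> denot e2 rho d
           & n = 0%R -> denot e3 rho d]]
  end.

(** * Small-step semantics *)

Fixpoint free_vars (e : exp) : seq var :=
  match e with
  | Num _ => [::]
  | Op _ e1 e2 => free_vars e1 ++ free_vars e2
  | Var x => [:: x]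
  | Lam x e1 => [seq y <- free_vars e1 | y != x]
  | App e1 e2 => free_vars e1 ++ free_vars e2
  | If e1 e2 e3 => free_vars e1 ++ free_vars e2 ++ free_vars e3
  end.

Inductive value : exp -> Prop :=
| value_num (n : int) : value (Num n)
| value_lam (x : var) (e : exp) :
    free_vars (Lam x e) = [::] -> value (Lam x e).

(* Only closed expressions are ever substituted, so no bound variable has to
   be renamed. *)
Fixpoint subst (x : var) (v : exp) (e : exp) : exp :=
  match e with
  | Num n => Num n
  | Op f e1 e2 => Op f (subst x v e1) (subst x v e2)
  | Var y => if y == x then v else Var y
  | Lam y e1 => Lam y (if y == x then e1 else subst x v e1)
  | App e1 e2 => App (subst x v e1) (subst x v e2)
  | If e1 e2 e3 => If (subst x v e1) (subst x v e2) (subst x v e3)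
  end.

Inductive step : exp -> exp -> Prop :=
| step_beta x e v : value v -> step (App (Lam x e) v) (subst x v e)
| step_op f n1 n2 : step (Op f (Num n1) (Num n2)) (Num (f n1 n2))
| step_if_nonzero n e2 e3 : n <> 0%R -> step (If (Num n) e2 e3) e2
| step_if_zero e2 e3 : step (If (Num 0%R) e2 e3) e3
| step_app1 e1 e1' e2 : step e1 e1' -> step (App e1 e2) (App e1' e2)
| step_op1 f e1 e1' e2 : step e1 e1' -> step (Op f e1 e2) (Op f e1' e2)
| step_if1 e1 e1' e2 e3 : step e1 e1' -> step (If e1 e2 e3) (If e1' e2 e3)
| step_app2 v e2 e2' : value v -> step e2 e2' -> step (App v e2) (App v e2')
| step_op2 f v e2 e2' : value v -> step e2 e2' -> step (Op f v e2) (Op f v e2').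

Definition steps : exp -> exp -> Prop := clos_refl_trans exp step.

Definition evaluates_to (e : exp) (n : int) : Prop := steps e (Num n).

Notation "e ⇓ n" := (evaluates_to e n) (at level 70, no associativity).

(* Main.v *)
Require Import Defs.

(** Every single step [e --> e'] preserves the denotation in every environment.
    The only interesting step is beta, which rests on the substitution lemma:
    [d] is in the denotation of [e[v/x]] iff it is in that of [e] with [x] bound
    to some element of the denotation of [v].  Under a lambda this requires
    merging the finitely many elements of [v] used by the entries of a table
    into one, which is possible since the denotation of a value is directed. *)

Set Implicit Arguments.
Unset Strict Implicit.
Unset Printing Implicit Defensive.

Local Open Scope classical_set_scope.

Lemma dle_refl (d : D) : d ⊑ d.
Proof.
by have [[n ->]|[t ->]] := D_case d; constructor; rewrite ?fsubset_refl.
Qed.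

Lemma dle_dint (d : D) (n : int) : d ⊑ dint n -> d = dint n.
Proof.
by move=> h; move E: (dint n) h => d' h; case: h E.
Qed.

Lemma dle_dtab (d : D) (t' : {fset D * D}) :
  d ⊑ dtab t' -> exists2 t, d = dtab t & (t `<=` t')%fset.
Proof.
move=> h; move E: (dtab t') h => d' h; case: h E => [n /esym/dint_dtab //|].
by move=> t t'' tt'' /dtab_inj ->; exists t.
Qed.

Lemma dle_trans (d1 d2 d3 : D) : d1 ⊑ d2 -> d2 ⊑ d3 -> d1 ⊑ d3.
Proof.
move=> h12 h23; case: h23 h12 => [n //|t t' tt'] /dle_dtab[t0 -> t0t].
by constructor; exact: fsubset_trans tt'.
Qed.

(** An integer lies above itself only, a part of a table satisfies the same entrywise condition, and
    the variable and application clauses are closed under [⊑] by transitivity. *)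
Lemma denot_down (e : exp) (rho : env) (d d' : D) :
  d' ⊑ d -> denot e rho d -> denot e rho d'.
Proof.
elim: e rho d d' => [n|f e1 _ e2 _|x|x e1 _|e1 _ e2 _|e1 _ e2 IH2 e3 IH3]
  rho d d' d'd /=.
- by move=> dE; rewrite dE in d'd; exact: dle_dint.
- move=> [n1 [n2 [h1 h2 dE]]]; exists n1, n2; split=> //.
  by rewrite dE in d'd; exact: dle_dint.
- by move=> [d0 rx dd0]; exists d0 => //; exact: dle_trans dd0.
- move=> [t dE h]; rewrite dE in d'd; have [t' -> t't] := dle_dtab d'd.
  by exists t' => // d1 d1' /(fsubsetP t't); exact: h.
- move=> [t [d1 [d1' [d2 [ht h2 dt d12 dd1]]]]]; exists t, d1, d1', d2.
  by split=> //; exact: dle_trans dd1.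
- move=> [n [hn h2 h3]]; exists n; split=> // n0.
  + exact: IH2 d'd (h2 n0).
  + exact: IH3 d'd (h3 n0).
Qed.

(** Taken at a single variable, so that monotonicity can ask for it on the free variables only;
    [denot_env_eq] then follows by using it in both directions. *)
Definition env_le_at (rho rho' : env) (x : var) : Prop :=
  forall d, rho x = Some d -> exists2 d', rho' x = Some d' & d ⊑ d'.

Lemma env_le_at_eq (rho rho' : env) (x : var) :
  rho x = rho' x -> env_le_at rho rho' x.
Proof. by move=> E d rx; exists d; [rewrite -E|exact: dle_refl]. Qed.

Lemma env_le_update (rho : env) (x : var) (d d' : D) (y : var) :
  d ⊑ d' -> env_le_at (update rho x d) (update rho x d') y.
Proof.
rewrite /env_le_at /update => dd' d0; case: eqP => _ h.
  by case: h => <-; exists d'.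
by exists d0 => //; exact: dle_refl.
Qed.

Lemma denot_mono (e : exp) (rho rho' : env) :
  (forall x, x \in free_vars e -> env_le_at rho rho' x) ->
  denot e rho `<=` denot e rho'.
Proof.
elim: e rho rho' =>
  [n|f e1 IH1 e2 IH2|x|x e1 IH1|e1 IH1 e2 IH2|e1 IH1 e2 IH2 e3 IH3]
  rho rho' /= le d //=.
- move=> [n1 [n2 [h1 h2 ->]]]; exists n1, n2.
  split=> //; [apply: IH1 h1|apply: IH2 h2] => y fy;
    by apply: le; rewrite mem_cat fy ?orbT.
- move=> [d0 rx dd0]; have [|d1 r'x d01] := le x _ d0 rx.
    by rewrite inE.
  by exists d1 => //; exact: dle_trans d01.
- move=> [t -> h]; exists t => // d1 d1' /h; apply: IH1 => y fy.
  rewrite /env_le_at /update; case: eqP => [_ d0 [<-]|/eqP yx].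
    by exists d1 => //; exact: dle_refl.
  by apply: le; rewrite mem_filter yx.
- move=> [t [d1 [d1' [d2 [ht h2 dt d12 dd1]]]]]; exists t, d1, d1', d2.
  split=> //; [apply: IH1 ht|apply: IH2 h2] => y fy;
    by apply: le; rewrite mem_cat fy ?orbT.
- move=> [n [hn h2 h3]]; exists n; split=> [|n0|n0];
    [apply: IH1 hn|apply: IH2 (h2 n0)|apply: IH3 (h3 n0)] => y fy;
    by apply: le; rewrite !mem_cat fy ?orbT.
Qed.

Lemma denot_env_eq (e : exp) (rho rho' : env) :
  (forall x, x \in free_vars e -> rho x = rho' x) ->
  denot e rho = denot e rho'.
Proof.
by move=> E; apply/seteqP; split; apply: denot_mono => x fx;
  apply: env_le_at_eq; rewrite E.
Qed.

Lemma denot_update_mono (e : exp) (rho : env) (x : var) (d d' : D) :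
  d ⊑ d' -> denot e (update rho x d) `<=` denot e (update rho x d').
Proof. by move=> dd'; apply: denot_mono => y _; exact: env_le_update. Qed.

Lemma denot_value (v : exp) (rho rho' : env) :
  value v -> denot v rho = denot v rho'.
Proof.
by move=> vv; apply: denot_env_eq => x; case: vv => // y e /= ->.
Qed.

Lemma denot_value_nonempty (v : exp) (rho : env) :
  value v -> exists d, denot v rho d.
Proof.
case=> [n|x e _]; first by exists (dint n).
by exists (dtab fset0); exists fset0.
Qed.

(** For an abstraction the upper bound is the union of the two tables: membership is a condition on
    each entry separately, so the union still satisfies it. *)
Lemma denot_value_directed (v : exp) (rho : env) (d1 d2 : D) :
  value v -> denot v rho d1 -> denot v rho d2 ->
  exists d, [/\ denot v rho d, d1 ⊑ d & d2 ⊑ d].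
Proof.
case=> [n|x e _] /=.
  by move=> -> ->; exists (dint n); split=> //; exact: dle_refl.
move=> [t1 -> h1] [t2 -> h2]; exists (dtab (t1 `|` t2)%fset); split.
- exists (t1 `|` t2)%fset => // a b.
  by rewrite inE => /orP[/h1|/h2].
- by constructor; exact: fsubsetUl.
- by constructor; exact: fsubsetUr.
Qed.

(** Directedness extended to finitely many requirements, each preserved upwards. It will be applied
    with [s] the entries of a table. *)
Lemma denot_value_merge (T : eqType) (Q : T -> D -> Prop) (v : exp)
    (rho : env) (s : seq T) :
  value v -> (forall p d d', d ⊑ d' -> Q p d -> Q p d') ->
  (forall p, p \in s -> exists2 d, denot v rho d & Q p d) ->
  exists2 d, denot v rho d & forall p, p \in s -> Q p d.
Proof.
move=> vv Qle; elim: s => [_|p s IH h].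
  by have [d vd] := denot_value_nonempty rho vv; exists d.
have [|d1 vd1 Q1] := h p; first by rewrite mem_head.
have [q qs|d2 vd2 Q2] := IH; first by apply: h; rewrite inE qs orbT.
have [d [vd d1d d2d]] := denot_value_directed vv vd1 vd2.
exists d => // q; rewrite inE => /orP[/eqP->|/Q2].
- exact: Qle d1d Q1.
- exact: Qle d2d.
Qed.

Lemma denot_subst_sub (x : var) (v e : exp) (rho : env) (d : D) :
  value v -> denot (subst x v e) rho d ->
  exists2 dv, denot v rho dv & denot e (update rho x dv) d.
Proof.
move=> vv.
(* Two subexpressions may use different elements of [v]; by monotonicity an upper bound serves
   both. *)
have merge2 e1 e2 r d1 d2 :
    (exists2 dv, denot v r dv & denot e1 (update r x dv) d1) ->
    (exists2 dv, denot v r dv & denot e2 (update r x dv) d2) ->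
  exists dv, [/\ denot v r dv, denot e1 (update r x dv) d1
    & denot e2 (update r x dv) d2].
  move=> [a va ha] [b vb hb].
  have [c [vc ac bc]] := denot_value_directed vv va vb.
  exists c; split=> //.
  - exact: denot_update_mono ac _ ha.
  - exact: denot_update_mono bc _ hb.
elim: e rho d =>
  [n|f e1 IH1 e2 IH2|y|y e1 IH1|e1 IH1 e2 IH2|e1 IH1 e2 IH2 e3 IH3] rho d /=.
(* Here [x] does not occur, so any element of the nonempty denotation of [v] will do. *)
- by move=> ->; have [dv] := denot_value_nonempty rho vv; exists dv.
- move=> [n1 [n2 [/IH1 h1 /IH2 h2 ->]]].
  have [dv [vdv {}h1 {}h2]] := merge2 _ _ _ _ _ h1 h2.
  by exists dv => //; exists n1, n2.
- rewrite /update; case: eqP => [_|yx] /= h.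
    by exists d => //; exists d => //; exact: dle_refl.
  by have [dv] := denot_value_nonempty rho vv; exists dv.
- move=> [t -> h].
  (* Each entry of [t] comes with its own element of [v]; one element is needed for the whole
     table. *)
  have [//|p a a' aa'|p pt|dv vdv hdv] := @denot_value_merge _
      (fun p dv => denot e1 (update (update rho x dv) y p.1) p.2)
      v rho (enum_fset t).
  + apply: denot_mono => z _; rewrite /env_le_at {1 3}/update.
    case: eqP => [_ b|_]; last exact: env_le_update.
    by exists b => //; exact: dle_refl.
  + case: p pt => a b /= /h; case: eqP => [yx|/eqP yx] hab.
      (* If [y] is [x], the inner binding shadows the outer one and the choice of [dv] is
         immaterial. *)
      have [dv vdv] := denot_value_nonempty rho vv; exists dv => //.
      rewrite (denot_env_eq (rho' := update rho y a)) // => z _.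
      by rewrite /update yx; case: eqP.
    have [dv vdv hdv] := IH1 _ _ hab.
    (* As [v] is closed, [dv] stays in its denotation outside the binder; updates at distinct
       variables commute. *)
    exists dv; first by rewrite (denot_value rho (update rho y a) vv).
    rewrite (denot_env_eq (rho' := update (update rho y a) x dv)) // => z _.
    by rewrite /update; case: (z =P y) => // ->; rewrite (negPf yx).
  + by exists dv => //; exists t => // a b abt; exact: (hdv (a, b)).
- move=> [t [d1 [d1' [d2 [/IH1 h1 /IH2 h2 dt d12 dd1]]]]].
  have [dv [vdv {}h1 {}h2]] := merge2 _ _ _ _ _ h1 h2.
  by exists dv => //; exists t, d1, d1', d2.
(* Only the selected branch supplies an element of [v] to merge; the condition on the other is
   vacuous. *)
- move=> [n [/IH1 h1 h2 h3]]; case: (n =P 0%R) => n0.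
    have [dv [vdv {}h1 {}h3]] := merge2 _ _ _ _ _ h1 (IH3 _ _ (h3 n0)).
    by exists dv => //; exists n.
  have [dv [vdv {}h1 {}h2]] := merge2 _ _ _ _ _ h1 (IH2 _ _ (h2 n0)).
  by exists dv => //; exists n.
Qed.

(** No merging here: the same [dv] serves every occurrence of [x], and an occurrence that uses less
    than [dv] is covered by [denot_down]. *)
Lemma denot_subst_sup (x : var) (v e : exp) (rho : env) (d dv : D) :
  value v -> denot v rho dv -> denot e (update rho x dv) d ->
  denot (subst x v e) rho d.
Proof.
move=> vv; elim: e rho d =>
  [n|f e1 IH1 e2 IH2|y|y e1 IH1|e1 IH1 e2 IH2|e1 IH1 e2 IH2 e3 IH3]
  rho d vdv //=.
- by move=> [n1 [n2 [/IH1 h1 /IH2 h2 ->]]]; exists n1, n2; split; auto.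
- rewrite /update; case: eqP => // _ [_ [<-] /denot_down]; exact.
- move=> [t -> h]; exists t => // a b /h; case: eqP => [->|/eqP yx] hab.
    rewrite (denot_env_eq (rho' := update (update rho x dv) x a)) // => z _.
    by rewrite /update; case: eqP.
  apply: IH1; first by rewrite (denot_value _ rho vv).
  rewrite (denot_env_eq (rho' := update (update rho x dv) y a)) // => z _.
  by rewrite /update; case: (z =P y) => // ->; rewrite (negPf yx).
- move=> [t [d1 [d1' [d2 [/IH1 h1 /IH2 h2 dt d12 dd1]]]]].
  by exists t, d1, d1', d2; split; auto.
- by move=> [n [/IH1 h1 h2 h3]]; exists n; split; auto.
Qed.

Lemma denot_beta (x : var) (e v : exp) (rho : env) :
  value v -> denot (App (Lam x e) v) rho = denot (subst x v e) rho.
Proof.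
move=> vv; apply/seteqP; split=> d /=.
  move=> [t [d1 [d1' [d2 [[_ /dtab_inj<- h] h2 dt d12 dd1]]]]].
  (* Downward closure absorbs both uses of [⊑] in the application clause, for the argument and for
     the result. *)
  apply: denot_subst_sup vv (denot_down d12 h2) _.
  exact: denot_down dd1 (h _ _ dt).
move=> /(denot_subst_sub vv)[dv vdv h].
(* A one-entry table records just the input-output pair that this call needs. *)
exists [fset (dv, d)]%fset, dv, d, dv; split=> //; try exact: dle_refl.
  by exists [fset (dv, d)]%fset => // a b; rewrite inE => /eqP[-> ->].
by rewrite inE.
Qed.

(** The semantics is compositional, so the congruence rules follow by rewriting with the induction
    hypothesis; only the base reductions need an argument. *)
Lemma denot_step (e e' : exp) (rho : env) :
  step e e' -> denot e rho = denot e' rho.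
Proof.
elim=> {e e'} [x e v vv|f n1 n2|n e2 e3 n0|e2 e3|e1 e1' e2 _ E|f e1 e1' e2 _ E|
  e1 e1' e2 e3 _ E|v e2 e2' _ _ E|f v e2 e2' _ _ E] /=; rewrite ?E //.
- exact: denot_beta.
- apply/seteqP; split=> d /= => [[_ [_ [/dint_inj-> /dint_inj-> ->]]]//|->].
  by exists n1, n2.
- apply/seteqP; split=> d /= => [[_ [/dint_inj-> h _]]|h]; first exact: h.
  by exists n; split.
- apply/seteqP; split=> d /= => [[_ [/dint_inj-> _ h]]|h]; first exact: h.
  by exists 0%R; split.
Qed.

Lemma denot_steps (e e' : exp) (rho : env) :
  steps e e' -> denot e rho = denot e' rho.
Proof.
by elim=> // [{}e {}e' /denot_step //|e1 e2 e3 _ -> _ ->].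
Qed.

Theorem theorem3 (e : exp) (n : int) :
  e ⇓ n -> denot e empty_env = denot (Num n) empty_env.
Proof. exact: denot_steps. Qed.
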